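(* Let $\mathbb{H}$ be a real Hilbert space and let $T \in B(\mathbb{H})$. Then $T$ is a smooth point of $B(\mathbb{H})$ if and only if there exists $x_0 \in S_{\mathbb{H}}$ such that $T$ attains its norm only at $\pm x_0$, i.e. $\{x \in S_{\mathbb{H}} : \|Tx\| = \|T\|\} = \{x_0, -x_0\}$, and $\sup\{\|Ty\| : y \in S_{\mathbb{H}},\ x_0 \perp y\} < \|T\|$.
   Context: $S_{\mathbb{H}} = \{x \in \mathbb{H} : \|x\| = 1\}$ and $x_0 \perp y$ means $\langle x_0, y\rangle = 0$. $B(\mathbb{H})$ is the normed space of bounded linear operators on $\mathbb{H}$ with the operator norm. A supremum of norms over the empty set is taken to be $0$. A non-zero element $u$ of a real normed space $\mathbb{Z}$ is a smooth point of $\mathbb{Z}$ if there is a unique linear functional $f \in \mathbb{Z}^*$ with $\|f\| = 1$ and $f(u) = \|u\|$. *)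

(* Defs.v *)
From HB Require Import structures.
From mathcomp Require Import all_boot all_order all_algebra.
From mathcomp Require Import all_classical all_reals all_analysis.

Set Implicit Arguments.
Unset Strict Implicit.
Unset Printing Implicit Defensive.

Import Order.TTheory GRing.Theory Num.Theory.
Import numFieldNormedType.Exports.

Local Open Scope classical_set_scope.
Local Open Scope ring_scope.

Definition unit_sphere (R : realType) (V : normedModType R) : set V :=
  [set x | `|x| = 1].
Arguments unit_sphere {R} V.

Definition bounded_linear (R : realType) (V W : normedModType R) :
    {pred V -> W} :=
  mem [set f : V -> W |
        linear f /\ exists M : R, forall x, `|f x| <= M * `|x|].
Arguments bounded_linear {R} V W.

Record bop (R : realType) (V W : normedModType R) := BOp {
  bop_fun :> V -> W ;
  bop_funP : bop_fun \in bounded_linear V W }.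
Arguments bop {R} V W.

Section bop_lmodule.
Context {R : realType} {V W : normedModType R}.

HB.instance Definition _ := [isSub for @bop_fun R V W].
HB.instance Definition _ := [Choice of bop V W by <:].

Lemma bounded_linear_submod_closed : submod_closed (bounded_linear V W).
Proof.
split.
  rewrite inE /=; split; first by move=> a x y /=; rewrite /= scaler0 addr0.
  by exists 0 => x; rewrite mul0r normr0.
move=> a f g; rewrite !inE /= => -[lf [M fM]] [lg [N gN]]; split.
  move=> b x y; change (a *: f (b *: x + y) + g (b *: x + y) =
    b *: (a *: f x + g x) + (a *: f y + g y)).
  by rewrite lf lg !scalerDr !scalerA mulrC addrACA.
exists (`|a| * M + N) => x; change (`|a *: f x + g x| <= (`|a| * M + N) * `|x|).
rewrite (le_trans (ler_normD _ _))// mulrDl lerD// normrZ -mulrA.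
by rewrite ler_wpM2l.
Qed.

HB.instance Definition _ := GRing.isSubmodClosed.Build R (V -> W)
  (bounded_linear V W) bounded_linear_submod_closed.
HB.instance Definition _ := [SubChoice_isSubLmodule of bop V W by <:].

Lemma bop_linear (f : bop V W) : linear f.
Proof. by case: f => f /=; rewrite inE => -[]. Qed.

HB.instance Definition _ (f : bop V W) :=
  GRing.isLinear.Build R V W *:%R f (bop_linear f).

End bop_lmodule.

Section bop_normed.
Context {R : realType} {V W : normedModType R}.
Implicit Types f g : bop V W.

(* [sup set0 = 0], so the operator norm is 0 when [V] is the zero space. *)
Definition op_norm f : R := sup [set `|f x| | x in unit_sphere V].

Lemma sphere_values_bounded f :
  has_ubound [set `|f x| | x in unit_sphere V].
Proof.
case: f => f fP /=; move: (fP); rewrite inE => -[_ [M fM]].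
by exists M => _ [x /= x1 <-]; rewrite (le_trans (fM x))// x1 mulr1.
Qed.

Lemma le_op_norm f x : `|x| = 1 -> `|f x| <= op_norm f.
Proof. by move=> x1; apply: ub_le_sup; [exact: sphere_values_bounded|exists x]. Qed.

Lemma op_norm_le f (M : R) :
  0 <= M -> (forall x, `|x| = 1 -> `|f x| <= M) -> op_norm f <= M.
Proof.
move=> M0 fM; rewrite /op_norm.
have [->|/set0P ne] := eqVneq [set `|f x| | x in unit_sphere V] set0.
  by rewrite sup0.
by apply: ge_sup => // _ [x /= x1 <-]; exact: fM.
Qed.

Lemma op_norm_ge0 f : 0 <= op_norm f.
Proof.
rewrite /op_norm.
have [->|/set0P[_ [x x1 _]]] :=
  eqVneq [set `|f x| | x in unit_sphere V] set0; first by rewrite sup0.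
exact: le_trans (le_op_norm f x1).
Qed.

Lemma op_normD f g : op_norm (f + g) <= op_norm f + op_norm g.
Proof.
apply: op_norm_le => [|x x1]; first by rewrite addr_ge0 ?op_norm_ge0.
change (`|f x + g x| <= op_norm f + op_norm g).
by rewrite (le_trans (ler_normD _ _))// lerD// le_op_norm.
Qed.

Lemma op_normZ_le (a : R) f : op_norm (a *: f) <= `|a| * op_norm f.
Proof.
apply: op_norm_le => [|x x1]; first by rewrite mulr_ge0 ?op_norm_ge0.
change (`|a *: f x| <= `|a| * op_norm f).
by rewrite normrZ ler_wpM2l// le_op_norm.
Qed.

Lemma op_normZ (a : R) f : op_norm (a *: f) = `|a| * op_norm f.
Proof.
apply/eqP; rewrite eq_le op_normZ_le /=.
have [->|a0] := eqVneq a 0; first by rewrite normr0 mul0r op_norm_ge0.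
rewrite -ler_pdivlMl ?normr_gt0// -normfV.
by rewrite -[f in leLHS](scalerK a0) op_normZ_le.
Qed.

Lemma op_norm_eq0 f : op_norm f = 0 -> f = 0.
Proof.
move=> f0; apply: val_inj; apply/funext => x; change (f x = 0).
have [->|x0] := eqVneq x 0; first by rewrite linear0.
have nx0 : `|x| != 0 by rewrite normr_eq0.
have x1 : `| `|x|^-1 *: x| = 1 by rewrite normrZ normfV normr_id mulVf.
apply/eqP; rewrite -[x](scalerKV nx0) linearZ /= scaler_eq0 (negPf nx0) /=.
by rewrite -normr_eq0 eq_le normr_ge0 andbT -f0 le_op_norm.
Qed.

HB.instance Definition _ := Lmodule_isNormed.Build R (bop V W)
  op_normD op_normZ op_norm_eq0.

Lemma bop_normE f : `|f| = sup [set `|f x| | x in unit_sphere V].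
Proof. by []. Qed.

End bop_normed.

(* [bop Z R^o] is the dual space of [Z] with the dual norm. *)
Definition smooth_point (R : realType) (Z : normedModType R) (u : Z) : Prop :=
  u != 0 /\ exists! f : bop Z R^o, `|f| = 1 /\ f u = `|u|.

(* Main.v *)
(** Call [defect x = |T|^2 |x|^2 - |Tx|^2] the nonnegative quadratic form measuring
    how far [x] is from norming [T].

    If [T] is smooth, all the functionals [A |-> lim <Ax, Tx> / |T|], the limit being
    along an ultrafilter of unit vectors with [|Tx| -> |T|], coincide, so [<Ax, Tx>]
    is almost constant on almost norming unit vectors. For [A] of the form
    [<-, x0> T x0] this isolates a maximizer [x0]. A maximizer exists: either the
    norm drops on the orthogonal complement of finitely many vectors, and then
    suitably normalized norming sequences are Cauchy, or there is an orthonormal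
    norming sequence, and [A = T P], with [P] the projection onto every other term,
    takes both values near [|T|^2] and the value 0.

    Conversely, an isolated maximizer [x0] yields
    [|T + t A|^2 <= |T|^2 + 2 t <T x0, A x0> + O(t^2)], which forces any norming
    functional to be [A |-> <T x0, A x0> / |T|]. *)
Require Import Defs.
From HB Require Import structures.
From mathcomp Require Import all_boot all_order all_algebra.
From mathcomp Require Import all_classical all_reals all_analysis.
From mathcomp Require Import ring lra.

Set Implicit Arguments.
Unset Strict Implicit.
Unset Printing Implicit Defensive.

Import Order.TTheory GRing.Theory Num.Theory.
Import numFieldNormedType.Exports.

Local Open Scope classical_set_scope.
Local Open Scope ring_scope.

(** * Elementary estimates for bounded operators *)

Section bounded_operators.
Context {R : realType} {V W : normedModType R}.

Lemma bop_le (f : bop V W) x : `|f x| <= `|f| * `|x|.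
Proof.
have [->|x0] := eqVneq x 0; first by rewrite linear0 !normr0 mulr0.
have nx0 : 0 < `|x| by rewrite normr_gt0.
have x1 : `| `|x|^-1 *: x| = 1 by rewrite normrZ normfV normr_id mulVf ?gt_eqF.
have := le_op_norm f x1; rewrite linearZ /= normrZ normfV normr_id.
by rewrite ler_pdivrMl// mulrC.
Qed.

Lemma bop_exists (f : V -> W) (M : R) : linear f ->
  0 <= M -> (forall x, `|f x| <= M * `|x|) ->
  exists2 g : bop V W, (forall x, g x = f x) & `|g| <= M.
Proof.
move=> lf M0 fM.
have fP : f \in bounded_linear V W by rewrite inE; split => //; exists M.
exists (BOp fP) => //; apply: op_norm_le => // x x1.
by rewrite (le_trans (fM x))// x1 mulr1.
Qed.

Lemma bopD (f g : bop V W) x : (f + g) x = f x + g x. Proof. by []. Qed.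

Lemma bopZ (a : R) (f : bop V W) x : (a *: f) x = a *: f x. Proof. by []. Qed.

Lemma bop_scale (f : bop V W) a x : f (a *: x) = a *: f x.
Proof. exact: linearZ. Qed.

Lemma bop_add (f : bop V W) x y : f (x + y) = f x + f y.
Proof. exact: linearD. Qed.

Lemma bop_sub (f : bop V W) x y : f (x - y) = f x - f y.
Proof. exact: linearB. Qed.

Lemma bop_eq (f g : bop V W) : (forall x, f x = g x) -> f = g.
Proof. by move=> fg; apply: val_inj; apply/funext. Qed.

Lemma bop_approx (f : bop V W) (e : R) : 0 < e -> f != 0 ->
  exists2 x, `|x| = 1 & `|f| - e < `|f x|.
Proof.
move=> e0 f0; apply: contrapT => nx.
have fle x : `|x| = 1 -> `|f x| <= `|f| - e.
  by move=> x1; rewrite leNgt; apply/negP => fx; apply: nx; exists x.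
have f_gt0 : 0 < `|f| by rewrite normr_gt0.
(* [op_norm_le] requires a nonnegative bound, and [|f| - e] may be negative. *)
have : `|f| <= Num.max 0 (`|f| - e).
  by apply: op_norm_le => [|x /fle]; rewrite le_max ?lexx// => ->; rewrite orbT.
by rewrite le_max leNgt f_gt0 /=; apply/negP; rewrite -ltNge ltrBlDr ltrDl.
Qed.

End bounded_operators.

(** * Polarization and the Cauchy-Schwarz inequality *)

Section inner_product.
Context {R : realType} {H : normedModType R} (ip : {dot H for @idfun R}).

Lemma ipC x y : ip x y = ip y x.
Proof. by rewrite hermC expr0 mul1r. Qed.

Lemma ipDl x y z : ip (x + y) z = ip x z + ip y z.
Proof. exact: linearDl. Qed.

Lemma ipZl a x y : ip (a *: x) y = a * ip x y.
Proof. exact: linearZl_LR. Qed.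

Lemma ipBl x y z : ip (x - y) z = ip x z - ip y z.
Proof. exact: linearBl. Qed.

Lemma ipDr x y z : ip z (x + y) = ip z x + ip z y.
Proof. by rewrite ipC ipDl !(ipC z). Qed.

Lemma ipZr a x y : ip x (a *: y) = a * ip x y.
Proof. by rewrite ipC ipZl (ipC x). Qed.

Lemma ipBr x y z : ip z (x - y) = ip z x - ip z y.
Proof. by rewrite ipC ipBl !(ipC z). Qed.

Lemma ip0l x : ip 0 x = 0.
Proof. by rewrite -(scale0r x) ipZl mul0r. Qed.

Lemma ip0r x : ip x 0 = 0.
Proof. by rewrite ipC ip0l. Qed.

Hypothesis ip_norm : forall x : H, ip x x = `|x| ^+ 2.

Lemma normD_sqr x y : `|x + y| ^+ 2 = `|x| ^+ 2 + 2 * ip x y + `|y| ^+ 2.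
Proof. by rewrite -!ip_norm ipDl !ipDr (ipC y x); ring. Qed.

Lemma normB_sqr x y : `|x - y| ^+ 2 = `|x| ^+ 2 - 2 * ip x y + `|y| ^+ 2.
Proof. by rewrite -!ip_norm ipBl !ipBr (ipC y x); ring. Qed.

Lemma ip_le x y : `|ip x y| <= `|x| * `|y|.
Proof.
have [->|y0] := eqVneq y 0; first by rewrite ip0r !normr0 mulr0.
have y2 : 0 < `|y| ^+ 2 by rewrite exprn_gt0 ?normr_gt0.
rewrite -(@ler_pXn2r _ 2) ?nnegrE ?mulr_ge0// exprMn -normrX ger0_norm ?sqr_ge0//.
rewrite -subr_ge0.
have := sqr_ge0 `| `|y| ^+ 2 *: x - ip x y *: y|.
rewrite normB_sqr !normrZ ipZl ipZr !exprMn -!normrX !ger0_norm ?sqr_ge0// => h.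
by rewrite -(pmulr_rge0 _ y2); nra.
Qed.

End inner_product.

(** * Norming functionals as ultrafilter limits *)

Lemma ultra_bounded_cvg {R : realType} {T : Type} (U : set_system T)
    (h : T -> R) (M : R) :
  UltraFilter U -> U [set x | `|h x| <= M] -> exists l : R, h @ U --> l.
Proof.
move=> UU UM.
(* Compactness of [[- M, M]] provides a cluster point, which is a limit for an ultrafilter. *)
have segM : U (h @^-1` `[- M, M]%classic).
  by apply: filterS UM => x /=; rewrite in_itv /= ler_norml.
have [l [_ clusterl]] := segment_compact _ (segM : (h @ U) _).
exists l => B Bl; have [//|UnB] := in_ultra_setVsetC (h @^-1` B) UU.
by have [y [nBy /nBy]] := clusterl _ _ (UnB : (h @ U) (~` B)) Bl.
Qed.

Section smooth_operators.
Context {R : realType} {H : normedModType R} (ip : {dot H for @idfun R}).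
Hypothesis ip_norm : forall x : H, ip x x = `|x| ^+ 2.
Context (T : bop H H).

(** Cauchy-Schwarz keeps [<Ax, Tx> / |T|] in [[- |A|, |A|]] on unit vectors, so its limit along [U]
    exists and is linear in [A]; the value at [T] forces norm 1. *)
Lemma norming_functional (U : set_system H) : UltraFilter U -> T != 0 ->
  U (unit_sphere H) -> `|T x| @[x --> U] --> `|T| ->
  exists f : bop (bop H H) R^o, [/\ `|f| = 1, f T = `|T| &
    forall A : bop H H, ip (A x) (T x) @[x --> U] --> `|T| * f A].
Proof.
move=> UU T0 U1 UT; have N0 : 0 < `|T| by rewrite normr_gt0.
have Nn0 : `|T| != 0 by rewrite gt_eqF.
pose phi (A : bop H H) x := `|T|^-1 * ip (A x) (T x).
have phiM A : U [set x | `|phi A x| <= `|A|].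
  apply: filterS U1 => x x1; rewrite /= /phi normrM normfV normr_id ler_pdivrMl//.
  rewrite (le_trans (ip_le ip_norm _ _))// mulrC.
  by apply: ler_pM => //; exact: le_op_norm.
have /choice[f f_cvg] A : exists l : R, phi A @ U --> l.
  exact: ultra_bounded_cvg (phiM A).
have f_lin : linear (f : bop H H -> R^o).
  move=> a A B; apply: (cvg_unique (@norm_hausdorff _ R^o) (f_cvg (a *: A + B))).
  have -> : phi (a *: A + B) = (fun x => a * phi A x + phi B x).
    by apply/funext => x; rewrite /phi bopD bopZ ipDl ipZl; ring.
  by apply: cvgD; [apply: cvgMl_tmp|]; exact: f_cvg.
have f_le A : `|f A : R^o| <= 1 * `|A|.
  by rewrite mul1r; apply: (cvgr_to_le (cvg_norm (f_cvg A))); exact: phiM.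
have [g gE g_le1] := bop_exists f_lin ler01 f_le.
have gT : g T = `|T|.
  rewrite gE; apply: (cvg_unique (@norm_hausdorff _ R^o) (f_cvg T)).
  have -> : phi T = (fun x => `|T|^-1 * (`|T x| * `|T x|)).
    by apply/funext => x; rewrite /phi ip_norm expr2.
  have := cvgMl_tmp (a := `|T|^-1) (cvgM UT UT).
  by rewrite (mulKf Nn0); apply.
exists g; split => //.
  apply/eqP; rewrite eq_le g_le1 -(ler_pM2r N0) mul1r.
  by have := bop_le g T; rewrite gT [X in X <= _](normr_id T).
move=> A; rewrite gE.
have -> : (fun x => ip (A x) (T x)) = (fun x => `|T| * phi A x).
  by apply/funext => x; rewrite /phi mulVKf.
by apply: cvgMl_tmp; exact: f_cvg.
Qed.

(* Otherwise ultrafilter limits along two families of almost norming vectors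
   would give two distinct norming functionals. *)
Lemma smooth_values_close (A : bop H H) (e : R) : smooth_point T -> 0 < e ->
  exists2 d, 0 < d & forall x y, `|x| = 1 -> `|y| = 1 ->
    `|T| - d < `|T x| -> `|T| - d < `|T y| ->
    `|ip (A x) (T x) - ip (A y) (T y)| < e.
Proof.
move=> [T0 [f [_ f_uniq]]] e0; set c := `|T| * f A.
suff [d d0 dP] : exists2 d, 0 < d & forall x, `|x| = 1 -> `|T| - d < `|T x| ->
    `|ip (A x) (T x) - c| < e / 2.
  exists d => // x y x1 y1 Tx Ty; rewrite (splitr e).
  by rewrite (le_lt_trans (ler_distD c _ _))// ltrD ?(distrC c) ?dP.
apply: contrapT => nd.
(* Almost norming vectors violating the bound. If no [d] works, these sets generate a proper filter;
   a finer ultrafilter gives a norming functional [g] that cannot agree with [f] at [A]. *)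
pose B d := [set x | [/\ `|x| = 1, `|T| - d < `|T x| &
  e / 2 <= `|ip (A x) (T x) - c|]].
have BP : ProperFilter (filter_from [set d : R | 0 < d] B).
  apply: filter_from_proper.
    apply: filter_from_filter; first by exists 1 => /=.
    move=> d1 d2 d10 d20; exists (Num.min d1 d2); first by rewrite /= lt_min d10.
    move=> x [x1 Tx Ax]; split; split => //; apply: le_lt_trans Tx.
      by rewrite lerB// ge_min lexx.
    by rewrite lerB// ge_min lexx orbT.
  move=> d d0; apply: contrapT => nB; apply: nd; exists d => // x x1 Tx.
  by rewrite ltNge; apply/negP => Ax; apply: nB; exists x.
have [U [UU BU]] := ultraFilterLemma BP.
have UB d : 0 < d -> U (B d) by move=> d0; apply: BU; exists d.
have U1 : U (unit_sphere H) by apply: filterS (UB _ ltr01) => x [].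
have UT : `|T x| @[x --> U] --> `|T|.
  apply/cvgrPdist_lt => d d0; apply: filterS (UB _ d0) => x [x1 Tx _].
  by rewrite ger0_norm ?subr_ge0 ?le_op_norm// ltrBlDr -ltrBlDl.
have [g [g1 gT g_cvg]] := norming_functional UU T0 U1 UT.
have e20 : 0 < e / 2 by rewrite divr_gt0.
have /cvgrPdist_lt/(_ _ e20) Ug := g_cvg A.
have [x [Ax [_ _]]] := filter_ex (filterI Ug (UB _ ltr01)).
by rewrite distrC leNgt /c (f_uniq _ (conj g1 gT)) Ax.
Qed.

End smooth_operators.

(** * The norm defect as a nonnegative quadratic form *)

Section norm_defect.
Context {R : realType} {H : normedModType R} (ip : {dot H for @idfun R}).
Hypothesis ip_norm : forall x : H, ip x x = `|x| ^+ 2.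
Context (T : bop H H).

Definition defect x : R := `|T| ^+ 2 * `|x| ^+ 2 - `|T x| ^+ 2.

Lemma defect_ge0 x : 0 <= defect x.
Proof.
rewrite subr_ge0 -exprMn ler_pXn2r ?nnegrE ?mulr_ge0//.
exact: bop_le.
Qed.

Lemma defectZ a x : defect (a *: x) = a ^+ 2 * defect x.
Proof.
rewrite /defect bop_scale !normrZ !exprMn real_normK ?num_real//. ring.
Qed.

Lemma defectD x y : defect (x + y) =
  defect x + defect y + 2 * (`|T| ^+ 2 * ip x y - ip (T x) (T y)).
Proof. by rewrite /defect bop_add !(normD_sqr ip_norm); ring. Qed.

Lemma defectB x y : defect (x - y) =
  defect x + defect y - 2 * (`|T| ^+ 2 * ip x y - ip (T x) (T y)).
Proof. by rewrite /defect bop_sub !(normB_sqr ip_norm); ring. Qed.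

(** Parallelogram law for the quadratic form, with [defect (x + y)] dropped. *)
Lemma defectB_le x y : defect (x - y) <= 2 * (defect x + defect y).
Proof. by have := defect_ge0 (x + y); rewrite defectD defectB; lra. Qed.

(** If [|Tx| <= |T| - d], the product [(|T| - |Tx|) (|T| + |Tx|)] is at least [d |T|]. *)
Lemma defect_gt x d : `|x| = 1 -> 0 < d -> defect x < d * `|T| ->
  `|T| - d < `|T x|.
Proof.
move=> x1 d0; rewrite /defect x1 expr1n mulr1 => dx.
rewrite ltNge; apply/negP => Tx; move: dx; apply/negP; rewrite -leNgt.
by have := normr_ge0 (T x); nra.
Qed.

(* The nonnegative quadratic [t |-> defect (x + t y)] vanishes at 0. *)
Lemma defect0_ip x y : defect x = 0 -> ip (T x) (T y) = `|T| ^+ 2 * ip x y.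
Proof.
move=> dx0; apply/eqP; rewrite eq_sym -subr_eq0; set b := _ - _.
have quad t : 0 <= t ^+ 2 * defect y + 2 * (t * b).
  have := defect_ge0 (x + t *: y).
  by rewrite defectD dx0 defectZ bop_scale !ipZr add0r -/b /b; lra.
(* Almost the minimizer [- b / defect y]; the added 1 keeps the denominator positive, and the value
   is still negative unless [b = 0]. *)
have := quad (- b / (defect y + 1)).
have dy0 : 0 < defect y + 1 by rewrite ltr_wpDl ?defect_ge0.
have dyn0 : defect y + 1 != 0 by rewrite gt_eqF.
have -> : (- b / (defect y + 1)) ^+ 2 * defect y +
    2 * (- b / (defect y + 1) * b) =
    - (b / (defect y + 1)) ^+ 2 * (defect y + 2) by field.
rewrite mulNr oppr_ge0 pmulr_lle0 ?ltr_wpDl ?defect_ge0// => b2.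
have : (b / (defect y + 1)) ^+ 2 == 0 by rewrite eq_le b2 sqr_ge0.
by rewrite sqrf_eq0 mulf_eq0 invr_eq0 (negPf dyn0) orbF.
Qed.

Lemma rank_one_exists (u v : H) :
  exists A : bop H H, forall x, A x = ip x u *: v.
Proof.
have lA : linear (fun x => ip x u *: v).
  by move=> a x y; rewrite ipDl ipZl scalerDl scalerA.
have [||A AE _] := bop_exists lA (M := `|u| * `|v|); last by exists A.
  by rewrite mulr_ge0.
move=> x; rewrite normrZ [leRHS]mulrC mulrA ler_wpM2r//.
exact: ip_le.
Qed.

(** For [A = <-, x0> T x0], the vanishing defect of [x0] turns [<Ax, Tx>] into [|T|^2 <x0, x>^2].
    Closeness of these values forces [<x0, x>^2 = 1] at every maximizer and keeps almost norming
    vectors out of the complement of [x0]. *)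
Lemma smooth_maximizer_isolated (x0 : H) : smooth_point T -> `|x0| = 1 ->
  `|T x0| = `|T| ->
  unit_sphere H `&` [set x | `|T x| = `|T|] = [set x0; - x0] /\
  sup [set `|T y| | y in unit_sphere H `&` [set y | ip x0 y = 0]] < `|T|.
Proof.
move=> smT x01 Tx0; have [T0 _] := smT.
have N0 : 0 < `|T| by rewrite normr_gt0.
have N20 : 0 < `|T| ^+ 2 by rewrite exprn_gt0.
have [A AE] := rank_one_exists x0 (T x0).
have dx0 : defect x0 = 0 by rewrite /defect x01 Tx0; ring.
have val x : ip (A x) (T x) = `|T| ^+ 2 * ip x0 x ^+ 2.
  by rewrite AE ipZl defect0_ip// (ipC _ x x0); ring.
have val0 : ip (A x0) (T x0) = `|T| ^+ 2 by rewrite val ip_norm x01; ring.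
split.
  apply/seteqP; split => [x [/= x1 Tx]|_ [->|->]]; last 2 first.
    by split.
    by rewrite /= /unit_sphere /= linearN !normrN.
  have : ip x0 x ^+ 2 = 1.
    apply: (mulfI (lt0r_neq0 N20)); rewrite mulr1 -val -val0; apply/eqP.
    rewrite -subr_eq0 -normr_le0; apply/ler_addgt0Pl => e e0; rewrite addr0.
    have [d d0 dP] := smooth_values_close ip_norm A smT e0.
    by apply/ltW/dP; rewrite ?Tx ?Tx0 ?ltrBlDr ?ltrDl.
  move/eqP; rewrite sqrf_eq1 => /orP[]/eqP x0x; [left|right]; apply/eqP.
    rewrite -subr_eq0 -normr_eq0 -sqrf_eq0 (normB_sqr ip_norm) x1 x01 ipC x0x.
    by apply/eqP; ring.
  rewrite -addr_eq0 -normr_eq0 -sqrf_eq0 (normD_sqr ip_norm) x1 x01 ipC x0x.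
  by apply/eqP; ring.
have [d d0 dP] := smooth_values_close ip_norm A smT N20.
have TN : `|T| - d < `|T x0| by rewrite Tx0 ltrBlDr ltrDl.
set S := [set _ | _ in _].
(* [S] is empty when [x0] spans [H]; its supremum is then 0. *)
have [->|/set0P S0] := eqVneq S set0; first by rewrite sup0.
apply: (@le_lt_trans _ _ (`|T| - d)); last by rewrite ltrBlDr ltrDl.
apply: ge_sup => // _ [y [/= y1 y0] <-]; rewrite leNgt; apply/negP => Ty.
have := dP _ _ x01 y1 TN Ty; rewrite val0 val y0 expr0n mulr0 subr0.
by rewrite ger0_norm ?ltxx// ltW.
Qed.

End norm_defect.

(** * Norming vectors and orthonormal norming sequences *)

Lemma cauchy_seq_cvg {R : realType} {V : completeNormedModType R} (w : nat -> V) :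
  (forall e : R, 0 < e -> exists m, forall n, (m <= n)%N -> `|w m - w n| < e) ->
  exists l : V, w @ \oo --> l.
Proof.
move=> w_cauchy; have : cvg (w @ \oo).
  apply/cauchy_cvgP/cauchy_exP => e e0; have [m wm] := w_cauchy _ e0.
  by exists (w m); exists m => // n /= mn; rewrite -ball_normE /=; exact: wm.
by move=> /cvg_ex[l wl]; exists l.
Qed.

Section norm_attainment.
Context {R : realType} {H : completeNormedModType R}.
Context (ip : {dot H for @idfun R}).
Hypothesis ip_norm : forall x : H, ip x x = `|x| ^+ 2.
Context (T : bop H H).

Definition orthogonal_to (s : seq H) (x : H) := forall v, v \in s -> ip x v = 0.

Lemma orthogonal_toZ s a x : orthogonal_to s x -> orthogonal_to s (a *: x).
Proof. by move=> sx v /sx; rewrite ipZl => ->; rewrite mulr0. Qed.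

Lemma orthogonal_toB s x y :
  orthogonal_to s x -> orthogonal_to s y -> orthogonal_to s (x - y).
Proof. by move=> sx sy v vs; rewrite ipBl sx ?sy ?subr0. Qed.

(* Almost norming vectors of [V := s^perp], normalized by [ip w u = 1], differ by
   elements of [V] orthogonal to [u], where the defect controls the norm. *)
Lemma norm_attained_of_gap (s : seq H) (u : H) (d : R) : T != 0 -> 0 < d ->
  (forall e, 0 < e ->
    exists x, [/\ `|x| = 1, orthogonal_to s x & `|T| - e < `|T x|]) ->
  (forall x, `|x| = 1 -> orthogonal_to s x -> ip x u = 0 ->
    `|T x| <= `|T| - d) ->
  exists x0, `|x0| = 1 /\ `|T x0| = `|T|.
Proof.
move=> T0 d0 approx gap; have N0 : 0 < `|T| by rewrite normr_gt0.
pose k := d * `|T|; have k0 : 0 < k by rewrite mulr_gt0.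
have coercive y : orthogonal_to s y -> ip y u = 0 -> k * `|y| ^+ 2 <= defect T y.
  move=> sy yu; have [->|y0] := eqVneq y 0.
    by rewrite normr0 expr0n mulr0 (defect_ge0 T).
  have ny0 : `|y| != 0 by rewrite normr_eq0.
  have y1 : `| `|y|^-1 *: y| = 1 by rewrite normrZ normfV normr_id mulVf.
  have : k <= defect T (`|y|^-1 *: y).
    rewrite leNgt; apply/negP => /(defect_gt y1 d0); apply/negP; rewrite -leNgt.
    by apply: gap => //; [exact: orthogonal_toZ|rewrite ipZl yu mulr0].
  by rewrite defectZ exprVn mulrC ler_pdivlMr ?exprn_gt0 ?normr_gt0.
have [x1 [sx1 x1u]] : exists x1, orthogonal_to s x1 /\ ip x1 u = 1.
  have [x [nx1 sx Tx]] := approx _ d0.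
  have xu : ip x u != 0.
    by apply: contraTneq Tx => xu; rewrite -leNgt gap.
  by exists ((ip x u)^-1 *: x); split; [exact: orthogonal_toZ|rewrite ipZl mulVf].
(* For a unit vector [x = z + a x1] of [V] with [ip z u = 0], coercivity and [defectB_le] give
   [k <= 4 defect x + a^2 C], so a small defect keeps [a] away from 0. *)
pose C := 4 * defect T x1 + 2 * k * `|x1| ^+ 2.
have C0 : 0 <= C.
  by rewrite addr_ge0 ?mulr_ge0 ?(defect_ge0 T) ?sqr_ge0// ltW.
have slice e : 0 < e ->
    exists w, [/\ orthogonal_to s w, ip w u = 1 & defect T w <= e].
  (* The bound [k / 8] yields [k / 2 <= a^2 C]; the second one then makes [defect x / a^2] at most
     [e]. *)
  move=> e0; pose e' := Num.min (k / 8) (e * k / (2 * (C + 1))).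
  have C1 : 0 < C + 1 by rewrite ltr_wpDl.
  have e'0 : 0 < e' by rewrite lt_min !divr_gt0 ?mulr_gt0.
  have [|x [nx1 sx Tx]] := approx (e' / (2 * `|T|)).
    by rewrite divr_gt0 ?mulr_gt0.
  have qx : defect T x <= e'.
    have Nn0 : `|T| != 0 by rewrite gt_eqF.
    have hTx : `|T x| <= `|T| := le_op_norm T nx1.
    have : 2 * `|T| * (`|T| - `|T x|) <= e'.
      by rewrite mulrC -ler_pdivlMr ?mulr_gt0//; lra.
    by rewrite /defect nx1 expr1n; nra.
  have [qx1 qx2] : defect T x <= k / 8 /\ defect T x <= e * k / (2 * (C + 1)).
    by split; apply: (le_trans qx); rewrite ge_min lexx ?orbT.
  pose a := ip x u; pose z := x - a *: x1.
  have zu : ip z u = 0 by rewrite ipBl ipZl x1u mulr1 subrr.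
  have sz : orthogonal_to s z by apply: orthogonal_toB => //; exact: orthogonal_toZ.
  have qz : defect T z <= 2 * (defect T x + a ^+ 2 * defect T x1).
    by rewrite -defectZ; exact: (defectB_le ip_norm).
  have nz : 1 <= 2 * `|z| ^+ 2 + 2 * (a ^+ 2 * `|x1| ^+ 2).
    have := sqr_ge0 `|z - a *: x1|; rewrite (normB_sqr ip_norm).
    have : `|z + a *: x1| ^+ 2 = 1 by rewrite subrK nx1 expr1n.
    rewrite (normD_sqr ip_norm) normrZ exprMn real_normK ?num_real//; lra.
  have aC : k / 2 <= a ^+ 2 * C.
    have := coercive _ sz zu; have : k * 1 <= k * (2 * `|z| ^+ 2 + 2 * (a ^+ 2 * `|x1| ^+ 2)).
      by rewrite ler_pM2l.
    rewrite /C; lra.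
  have a2 : 0 < a ^+ 2.
    rewrite lt0r sqr_ge0 andbT; apply: contraTneq aC => ->.
    by rewrite mul0r -ltNge divr_gt0.
  have an0 : a != 0 by rewrite -sqrf_eq0 gt_eqF.
  exists (a^-1 *: x); split; first exact: orthogonal_toZ.
    by rewrite ipZl mulVf.
  rewrite defectZ exprVn mulrC ler_pdivrMr// (le_trans qx2)//.
  rewrite ler_pdivrMr ?mulr_gt0// -mulrA ler_pM2l//.
  by nra.
pose r n : R := harmonic n.
have r0 n : 0 < r n by rewrite /r invr_gt0.
(* With the factor [k / 4], [defectB_le] and coercivity give [|w m - w n| <= r m] for [m <= n]. *)
have /choice[w wP] n : exists w, [/\ orthogonal_to s w, ip w u = 1 &
    defect T w <= k / 4 * r n ^+ 2].
  by apply: slice; rewrite mulr_gt0 ?divr_gt0 ?exprn_gt0.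
have r_lt e : 0 < e -> exists m, forall n, (m <= n)%N -> r n < e.
  move=> e0; have [m _ rm] := near_infty_natSinv_lt (PosNum e0).
  by exists m => n mn; exact: rm.
have r_le m n : (m <= n)%N -> r n <= r m.
  by move=> mn; rewrite /r /harmonic lef_pV2 ?posrE// ler_nat.
have [l wl] : exists l : H, w @ \oo --> l.
  apply: cauchy_seq_cvg => e /r_lt[m rm]; exists m => n mn.
  apply: le_lt_trans (rm _ (leqnn m)).
  have [sm um qm] := wP m; have [sn un qn] := wP n.
  rewrite -(@ler_pXn2r _ 2) ?nnegrE ?(ltW (r0 m))// -(ler_pM2l k0).
  rewrite (le_trans (coercive _ _ _))//; first exact: orthogonal_toB.
    by rewrite ipBl um un subrr.
  have rmn : r n ^+ 2 <= r m ^+ 2 by rewrite ler_pXn2r ?nnegrE ?(ltW (r0 _)) ?r_le.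
  have := defectB_le ip_norm T (w m) (w n); nra.
have wl_lt e : 0 < e -> exists n, `|l - w n| < e /\ r n < e.
  move=> e0; move/cvgrPdist_lt : wl => /(_ _ e0)[m1 _ wm1].
  have [m2 rm2] := r_lt _ e0; exists (maxn m1 m2).
  by split; [apply: wm1; exact: leq_maxl|apply: rm2; exact: leq_maxr].
(* Since [ip (w n) u = 1], Cauchy-Schwarz keeps the [w n] away from 0. *)
have l0 : l != 0.
  apply/eqP => l0; have [n [+ _]] := wl_lt (`|u| + 1)^-1 ltac:(by rewrite invr_gt0 ltr_wpDl).
  rewrite l0 sub0r normrN; apply/negP; rewrite -leNgt.
  have [_ un _] := wP n; have := ip_le ip_norm (w n) u; rewrite un normr1 => h.
  rewrite -[leLHS]mul1r ler_pdivrMr ?ltr_wpDl//.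
  by rewrite mulrDr mulr1 (le_trans h)// lerDl.
have ql : defect T l = 0.
  apply/eqP; rewrite eq_le (defect_ge0 T) andbT; apply/ler_addgt0Pl => e e0; rewrite addr0.
  (* The sum of the coefficients in [defect l <= 2 |T|^2 |l - w n|^2 + (k / 2) (r n)^2]; the minimum
     with 1 below lets [e / c] bound the squares. *)
  pose c := k / 2 + 2 * `|T| ^+ 2.
  have c0 : 0 < c by rewrite addr_gt0 ?divr_gt0 ?mulr_gt0 ?exprn_gt0.
  have [n [ln rn]] := wl_lt (Num.min 1 (e / c)) ltac:(by rewrite lt_min ltr01 divr_gt0).
  move: ln rn; rewrite !lt_min => /andP[l1 lc] /andP[r1 rc].
  have [_ _ qn] := wP n.
  have := defectB_le ip_norm T (l - w n) (- w n).
  have -> : l - w n - - w n = l by rewrite opprK subrK.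
  have -> : defect T (- w n) = defect T (w n) by rewrite -scaleN1r defectZ sqrrN expr1n mul1r.
  have : defect T (l - w n) <= `|T| ^+ 2 * `|l - w n| ^+ 2.
    by rewrite /defect lerBlDr lerDl sqr_ge0.
  have sq_lt (t : R) : 0 <= t -> t < 1 -> t < e / c -> t ^+ 2 <= e / c.
    by move=> t0 t1 tc; rewrite (le_trans _ (ltW tc))// expr2 ler_piMr// ltW.
  have := sq_lt _ (normr_ge0 _) l1 lc; have := sq_lt _ (ltW (r0 n)) r1 rc.
  move=> h1 h2 h3 h4.
  have : c * (e / c) = e by rewrite mulrC divfK ?gt_eqF.
  have := exprn_gt0 2 N0; rewrite /c; nra.
have nl0 : `|l| != 0 by rewrite normr_eq0.
have nl1 : `| `|l|^-1 *: l| = 1 by rewrite normrZ normfV normr_id mulVf.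
exists (`|l|^-1 *: l); split => //.
have : defect T (`|l|^-1 *: l) = 0 by rewrite defectZ ql mulr0.
rewrite /defect nl1 expr1n mulr1 => /eqP; rewrite subr_eq0 => /eqP h.
by apply/esym/eqP; rewrite -(@eqrXn2 _ 2) ?h.
Qed.

(** If almost norming vectors disappeared when one more vector joined the list [s],
    [norm_attained_of_gap] would give a maximizer. So they exist orthogonally to every finite list
    and can be chosen recursively. *)
Lemma orthonormal_norming_seq : T != 0 ->
  ~ (exists x0, `|x0| = 1 /\ `|T x0| = `|T|) ->
  exists e : nat -> H, [/\ forall n, `|e n| = 1,
    forall m n, (m < n)%N -> ip (e n) (e m) = 0 &
    forall n, `|T| - harmonic n < `|T (e n)|].
Proof.
move=> T0 nattained.
have step (s : seq H) : forall d, 0 < d ->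
    exists x, [/\ `|x| = 1, orthogonal_to s x & `|T| - d < `|T x|].
  elim: s => [|u s IHs] d d0.
    by have [x x1 Tx] := bop_approx d0 T0; exists x.
  apply: contrapT => nx; apply: nattained.
  apply: (norm_attained_of_gap (u := u) T0 d0 IHs) => x x1 sx xu.
  rewrite leNgt; apply/negP => Tx; apply: nx; exists x; split => // v.
  by rewrite inE => /predU1P[->//|/sx].
have /choice[g gP] (s : seq H) : exists x, [/\ `|x| = 1, orthogonal_to s x &
    `|T| - harmonic (size s) < `|T x|] by apply: step; rewrite invr_gt0.
(* The first [n] chosen vectors, latest first; the size of the list sets the tolerance. *)
pose L := fix L n := if n is m.+1 then g (L m) :: L m else [::].
have sizeL n : size (L n) = n by elim: n => //= n ->.
exists (fun n => g (L n)); split => [n|m n|n].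
- by have [] := gP (L n).
- move=> mn; have [_ + _] := gP (L n); apply.
  elim: n mn => // n IHn; rewrite ltnS leq_eqVlt inE => /predU1P[->|/IHn ->].
    by rewrite eqxx.
  by rewrite orbT.
- by have [_ _] := gP (L n); rewrite sizeL.
Qed.

End norm_attainment.

(** * Orthogonal projection onto the closed span of an orthonormal sequence *)

Section orthonormal_sequences.
Context {R : realType} {H : completeNormedModType R}.
Context (ip : {dot H for @idfun R}).
Hypothesis ip_norm : forall x : H, ip x x = `|x| ^+ 2.
Context (e : nat -> H).
Hypothesis e_norm : forall n, `|e n| = 1.
Hypothesis e_orth : forall m n, (m < n)%N -> ip (e n) (e m) = 0.

Let fourier x n := \sum_(0 <= i < n) ip x (e i) *: e i.
Let bessel x n := \sum_(0 <= i < n) ip x (e i) ^+ 2.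

Let fourierS x n : fourier x n.+1 = fourier x n + ip x (e n) *: e n.
Proof. by rewrite /fourier big_nat_recr. Qed.

Let besselS x n : bessel x n.+1 = bessel x n + ip x (e n) ^+ 2.
Proof. by rewrite /bessel big_nat_recr. Qed.

Let fourier_orth x m n : (m <= n)%N -> ip (fourier x m) (e n) = 0.
Proof.
elim: m => [_|m IHm mn]; first by rewrite /fourier big_geq// ip0l.
by rewrite fourierS ipDl ipZl (ipC _ (e m)) e_orth// mulr0 addr0 IHm// ltnW.
Qed.

Let fourier_dist x m n : (m <= n)%N ->
  `|fourier x n - fourier x m| ^+ 2 = bessel x n - bessel x m.
Proof.
elim: n => [|n IHn].
  by rewrite leqn0 => /eqP ->; rewrite !subrr normr0 expr0n.
rewrite leq_eqVlt => /predU1P[->|]; first by rewrite !subrr normr0 expr0n.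
rewrite ltnS => mn; rewrite fourierS besselS addrAC (normD_sqr ip_norm) IHn//.
rewrite normrZ e_norm mulr1 real_normK ?num_real// ipZr ipBl !fourier_orth//.
by ring.
Qed.

Let fourier0 x : fourier x 0 = 0. Proof. by rewrite /fourier big_geq. Qed.
Let bessel0 x : bessel x 0 = 0. Proof. by rewrite /bessel big_geq. Qed.

Let fourier_norm x n : `|fourier x n| ^+ 2 = bessel x n.
Proof. by rewrite -[bessel x n]subr0 -(bessel0 x) -fourier_dist// fourier0 subr0. Qed.

Let bessel_le x n : bessel x n <= `|x| ^+ 2.
Proof.
rewrite -subr_ge0; suff <- : `|x - fourier x n| ^+ 2 = `|x| ^+ 2 - bessel x n.
  exact: sqr_ge0.
elim: n => [|n IHn]; first by rewrite fourier0 bessel0 !subr0.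
rewrite fourierS besselS opprD addrA (normB_sqr ip_norm) IHn.
rewrite normrZ e_norm mulr1 real_normK ?num_real// ipZr ipBl fourier_orth//.
by ring.
Qed.

(** [P x] is the limit of the partial Fourier sums, which are Cauchy by Pythagoras and Bessel. For
    the two kinds of vectors considered these sums are eventually constant. *)
Lemma orthonormal_projection : exists P : bop H H,
  (forall n, P (e n) = e n) /\ (forall x, (forall n, ip x (e n) = 0) -> P x = 0).
Proof.
have /choice[P P_cvg] x : exists l : H, fourier x @ \oo --> l.
  have bessel_cvg : cvgn (bessel x).
    apply: nondecreasing_is_cvgn.
      by apply/nondecreasing_seqP => n; rewrite besselS lerDl sqr_ge0.
    by exists (`|x| ^+ 2) => _ [n _ <-]; exact: bessel_le.
  apply: cauchy_seq_cvg => d d0.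
  have d2 : 0 < d ^+ 2 / 2 by rewrite divr_gt0 ?exprn_gt0.
  move/cvgrPdist_lt : bessel_cvg => /(_ _ d2)[m _ bm]; exists m => n mn.
  rewrite distrC -(@ltr_pXn2r _ 2) ?nnegrE ?(ltW d0)// fourier_dist//.
  have := bm _ (leqnn m); have := bm _ mn; rewrite !ltr_norml.
  by move=> /andP[? ?] /andP[? ?]; lra.
have P_eq x l : (exists m, forall n, (m <= n)%N -> fourier x n = l) -> P x = l.
  move=> [m ml]; apply: (cvg_unique (@norm_hausdorff _ H) (P_cvg x)).
  by apply: cvg_near_cst; exists m.
have P_lin : linear P.
  move=> a x y; apply: (cvg_unique (@norm_hausdorff _ H) (P_cvg (a *: x + y))).
  have -> : fourier (a *: x + y) = (fun n => a *: fourier x n + fourier y n).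
    apply/funext => n; rewrite /fourier scaler_sumr -big_split /=.
    by apply: eq_bigr => i _; rewrite ipDl ipZl scalerDl scalerA.
  by apply: cvgD; [apply: cvgZl_tmp|]; exact: P_cvg.
have P_le x : `|P x| <= 1 * `|x|.
  rewrite mul1r; apply: (cvgr_to_le (cvg_norm (P_cvg x))).
  near=> n; rewrite -(@ler_pXn2r _ 2) ?nnegrE// fourier_norm.
  exact: bessel_le.
have [Q QE _] := bop_exists P_lin ler01 P_le.
exists Q; split => [n|x xe]; rewrite QE; apply: P_eq.
  exists n.+1 => m; elim: m => // m IHm; rewrite ltnS leq_eqVlt fourierS.
  case/predU1P => [<-|nm].
    rewrite ip_norm e_norm expr1n scale1r /fourier big1_seq ?add0r// => i.
    by rewrite mem_index_iota => /andP[_ /andP[_ im]]; rewrite e_orth// scale0r.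
  by rewrite IHm// ipC e_orth// scale0r addr0.
exists 0 => m _; rewrite /fourier big1_seq// => i _.
by rewrite xe scale0r.
Unshelve. all: by end_near. Qed.

End orthonormal_sequences.

(** * Smooth operators attain their norm *)

Section smoothness.
Context {R : realType} {H : completeNormedModType R}.
Context (ip : {dot H for @idfun R}).
Hypothesis ip_norm : forall x : H, ip x x = `|x| ^+ 2.
Context (T : bop H H).

(* If the norm is not attained, [T \o P] with [P] the projection onto every other
   vector of an orthonormal norming sequence separates two norming families. *)
Lemma smooth_attains : smooth_point T -> exists x0, `|x0| = 1 /\ `|T x0| = `|T|.
Proof.
move=> smT; have [T0 _] := smT; have N0 : 0 < `|T| by rewrite normr_gt0.
apply: contrapT => nattained.
have [e [e1 e_orth eT]] := orthonormal_norming_seq ip_norm T0 nattained.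
have ortho m n : m != n -> ip (e m) (e n) = 0.
  by rewrite neq_ltn => /orP[/e_orth|/e_orth//]; rewrite ipC.
have [||P [Pe P0]] := orthonormal_projection ip_norm (e := fun n => e n.*2).
- by move=> n; exact: e1.
- by move=> m n mn; apply: e_orth; rewrite ltn_double.
have TP_lin : linear (T \o P).
  by move=> a x y; rewrite /= linearP bop_add bop_scale.
have [||A AE _] := bop_exists TP_lin (M := `|T| * `|P|).
- by rewrite mulr_ge0.
- by move=> x; rewrite -mulrA (le_trans (bop_le _ _))// ler_wpM2l// bop_le.
(* At large indices the value is above [|T|^2 / 4] on even terms, where [|T| / 2 < |T (e m)|], and 0
   on odd ones. *)
have [|d d0 dP] := smooth_values_close ip_norm A smT (e := `|T| ^+ 2 / 4).
  by rewrite divr_gt0 ?exprn_gt0.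
have d'0 : 0 < Num.min d (`|T| / 2) by rewrite lt_min d0 divr_gt0.
have [n _ n_le] := near_infty_natSinv_lt (PosNum d'0).
have eT' m : (n <= m)%N -> `|T| - d < `|T (e m)| /\ `|T| / 2 < `|T (e m)|.
  have := eT m; rewrite /harmonic /= => + /n_le /=; rewrite lt_min.
  by move: (_^-1) => r Tm /andP[rd rT]; split; lra.
have n2 : (n <= n.*2)%N by rewrite -addnn leq_addr.
have [T1 T1'] := eT' _ n2; have [T2 _] := eT' _ (leqW n2).
have := dP _ _ (e1 n.*2) (e1 n.*2.+1) T1 T2.
rewrite !AE /= Pe P0; last first.
  move=> m; apply: ortho; apply/eqP => /(congr1 odd).
  by rewrite /= !odd_double.
rewrite linear0 ip0l subr0 ip_norm ger0_norm ?sqr_ge0// => lt4.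
have := N0; nra.
Qed.

End smoothness.

(** * An isolated maximizer implies smoothness *)

Section isolated_maximizer.
Context {R : realType} {H : normedModType R} (ip : {dot H for @idfun R}).
Hypothesis ip_norm : forall x : H, ip x x = `|x| ^+ 2.
Context (T : bop H H) (x0 : H) (s : R).
Hypotheses (x01 : `|x0| = 1) (Tx0 : `|T x0| = `|T|) (s0 : 0 <= s) (sN : s < `|T|).
Hypothesis Tperp : forall z, ip x0 z = 0 -> `|T z| <= s * `|z|.

(* Since [T x0] is orthogonal to the image of [x0^perp], the first-order terms
   in [z := x - <x,x0> x0] are absorbed by [- (|T|^2 - s^2) |z|^2]. *)
Lemma norm_perturbation (A : bop H H) : exists2 K, 0 <= K &
  forall t, 0 < t ->
    `|T + t *: A| ^+ 2 <= `|T| ^+ 2 + 2 * t * ip (T x0) (A x0) + K * t ^+ 2.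
Proof.
set N := `|T|; set M := `|A|; set c := ip (T x0) (A x0).
have N0 : 0 <= N by exact: normr_ge0.
have M0 : 0 <= M by exact: normr_ge0.
pose D := N ^+ 2 - s ^+ 2.
have D0 : 0 < D by rewrite subr_gt0 ltr_pXn2r ?nnegrE.
(* The first term times [t^2] is the maximum of [8 t N M |z| - D |z|^2] over [|z|]; the second
   bounds [|A x|^2]. *)
pose K := 16 * (N * M) ^+ 2 / D + M ^+ 2.
exists K => [|t t0].
  by rewrite addr_ge0 ?sqr_ge0// divr_ge0 ?(ltW D0)// mulr_ge0// sqr_ge0.
set E := leRHS.
have bound x : `|x| = 1 -> `|(T + t *: A) x| ^+ 2 <= E.
  move=> x1; pose a := ip x x0; pose z := x - a *: x0.
  have xE : x = a *: x0 + z by rewrite addrC subrK.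
  have zx0 : ip x0 z = 0 by rewrite ipBr ipZr ip_norm x01 (ipC _ x0 x) /a; ring.
  clearbody z; clearbody a.
  have a2 : a ^+ 2 + `|z| ^+ 2 = 1.
    have := normD_sqr ip_norm (a *: x0) z.
    rewrite -xE ipZl zx0 normrZ x01 x1 mulr1 real_normK ?num_real// expr1n => ->.
    by ring.
  have z0 := normr_ge0 z.
  have z1 : `|z| <= 1 by rewrite -(@ler_pXn2r _ 2) ?nnegrE// expr1n; nra.
  have a1 : `|a| <= 1.
    by rewrite -(@ler_pXn2r _ 2) ?nnegrE// expr1n real_normK ?num_real//; nra.
  have TT : ip (T x0) (T z) = 0.
    rewrite (defect0_ip ip_norm) ?zx0 ?mulr0//.
    by rewrite /defect x01 Tx0; ring.
  have Tx : `|T x| ^+ 2 <= N ^+ 2 - D * `|z| ^+ 2.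
    rewrite xE bop_add bop_scale (normD_sqr ip_norm (a *: T x0)) ipZl TT normrZ Tx0.
    rewrite exprMn real_normK ?num_real// -/N.
    have : `|T z| ^+ 2 <= (s * `|z|) ^+ 2.
      by rewrite ler_pXn2r ?nnegrE ?mulr_ge0// Tperp.
    rewrite exprMn /D; have -> : a ^+ 2 = 1 - `|z| ^+ 2 by rewrite -a2; ring.
    by nra.
  have TA u v : `|ip (T u) (A v)| <= N * M * (`|u| * `|v|).
    by rewrite (le_trans (ip_le ip_norm _ _))// mulrACA ler_pM// bop_le.
  (* Four error terms, each at most [N M |z|]: three contain [z] as an argument, and the fourth
     comes from [a^2 = 1 - |z|^2]. *)
  have cross : ip (T x) (A x) <= c + 4 * (N * M * `|z|).
    rewrite xE !bop_add !bop_scale !(ipDl, ipDr, ipZl, ipZr) -/c.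
    have NMz : 0 <= N * M * `|z| by rewrite !mulr_ge0.
    have scale b : `|b| <= N * M * `|z| -> a * b <= N * M * `|z|.
      move=> bz; rewrite (le_trans (ler_norm _))// normrM.
      by rewrite (le_trans _ bz)// ler_piMl.
    have h1 : a * ip (T x0) (A z) <= N * M * `|z|.
      by apply: scale; have := TA x0 z; rewrite x01 mul1r.
    have h2 : a * ip (T z) (A x0) <= N * M * `|z|.
      by apply: scale; have := TA z x0; rewrite x01 mulr1.
    have zz : `|z| * `|z| <= `|z| by rewrite ler_piMl.
    have NM0 : 0 <= N * M by rewrite mulr_ge0.
    have h3 : ip (T z) (A z) <= N * M * `|z|.
      rewrite (le_trans (ler_norm _))// (le_trans (TA _ _))//.
      by rewrite ler_wpM2l.
    have h4 : - (`|z| ^+ 2 * c) <= N * M * `|z|.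
      rewrite -mulrN (le_trans (ler_norm _))// normrM normrN normrX normr_id.
      have := TA x0 x0; rewrite x01 !mulr1 -/c => cNM.
      rewrite mulrC ler_pM// expr2//.
    have -> : a * (a * c) = c - `|z| ^+ 2 * c.
      by rewrite (_ : `|z| ^+ 2 = 1 - a ^+ 2); [ring|rewrite -a2; ring].
    lra.
  have Ax : `|A x| ^+ 2 <= M ^+ 2.
    by rewrite ler_pXn2r ?nnegrE//; have := bop_le A x; rewrite x1 mulr1.
  have absorb : 8 * t * (N * M) * `|z| - D * `|z| ^+ 2 <=
      16 * (N * M) ^+ 2 / D * t ^+ 2.
    rewrite -subr_ge0; have Dn0 : D != 0 by rewrite gt_eqF.
    have -> : 16 * (N * M) ^+ 2 / D * t ^+ 2 -
        (8 * t * (N * M) * `|z| - D * `|z| ^+ 2) =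
        D * (4 * (N * M) * t / D - `|z|) ^+ 2 by field.
    by rewrite mulr_ge0 ?sqr_ge0// ltW.
  rewrite bopD bopZ (normD_sqr ip_norm) ipZr normrZ exprMn.
  rewrite real_normK ?num_real// /E /K.
  have : t * ip (T x) (A x) <= t * (c + 4 * (N * M * `|z|)) by rewrite ler_pM2l.
  have : t ^+ 2 * `|A x| ^+ 2 <= t ^+ 2 * M ^+ 2.
    by rewrite ler_wpM2l ?sqr_ge0.
  lra.
have E0 : 0 <= E by rewrite (le_trans _ (bound _ x01))// sqr_ge0.
rewrite -[leRHS](sqr_sqrtr E0) ler_pXn2r ?nnegrE ?sqrtr_ge0//.
apply: op_norm_le => [|x x1]; first exact: sqrtr_ge0.
by rewrite -[leLHS]ger0_norm// -sqrtr_sqr ler_wsqrtr// bound.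
Qed.

(** The number [g (T + t A) = |T| + t g A] is at most [|T + t A|] in absolute value; after squaring,
    the first-order terms in [norm_perturbation] are compared for small [t]. *)
Lemma norming_functional_le (g : bop (bop H H) R^o) : `|g| = 1 -> g T = `|T| ->
  forall A, `|T| * g A <= ip (T x0) (A x0).
Proof.
move=> g1 gT A; have [K K0 KP] := norm_perturbation A.
(* After division by [2 t] the error is at most [K t / 2], below [e] for this [t]. *)
apply/ler_addgt0Pr => e e0; pose t := e / (K + 1).
have K1 : 0 < K + 1 by rewrite ltr_wpDl.
have t0 : 0 < t by rewrite divr_gt0.
have tK : t * (K + 1) = e by rewrite divfK ?gt_eqF.
have gA : (`|T| + t * g A) ^+ 2 <= `|T + t *: A| ^+ 2.
  have -> : `|T| + t * g A = g (T + t *: A) by rewrite bop_add bop_scale gT.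
  rewrite -[leLHS]real_normK ?num_real// ler_pXn2r ?nnegrE//.
  by have := bop_le g (T + t *: A); rewrite g1 mul1r.
have := le_trans gA (KP _ t0) => h.
rewrite -(ler_pM2l t0); have := sqr_ge0 (t * g A).
nra.
Qed.

(** The principal ultrafilter at [x0] provides a norming functional. Any other lies below it and, by
    the same inequality at [- A], also above it. *)
Lemma smooth_of_isolated_maximizer : smooth_point T.
Proof.
have N0 : 0 < `|T| by exact: le_lt_trans sN.
have T0 : T != 0 by rewrite -normr_gt0.
split => //; have UU := principal_filter_ultra x0.
have cvg0 (h : H -> R) : h @ principal_filter x0 --> h x0.
  by move=> B /nbhs_singleton Bx; apply/principal_filterP.
have [||f [f1 fT f_cvg]] := norming_functional ip_norm UU T0.
- exact/principal_filterP.
- by have := cvg0 (fun x => `|T x|); rewrite Tx0.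
exists f; split => // g [g1 gT]; apply: bop_eq => A.
have fA : `|T| * f A = ip (T x0) (A x0).
  rewrite ipC; apply: (cvg_unique (@norm_hausdorff _ R^o) (f_cvg A)).
  exact: (cvg0 (fun x => ip (A x) (T x))).
apply: (mulfI (lt0r_neq0 N0)); apply/eqP; rewrite fA eq_le.
rewrite (norming_functional_le g1 gT) andbT.
have := norming_functional_le g1 gT (- 1 *: A).
by rewrite bop_scale bopZ ipZr !scaleN1r mulN1r mulrN lerN2.
Qed.

End isolated_maximizer.

Theorem theorem4p6 (R : realType) (H : completeNormedModType R)
    (ip : {dot H for @idfun R}) (ip_norm : forall x : H, ip x x = `|x| ^+ 2)
    (T : bop H H) :
  smooth_point T <->
  exists x0 : H,
    [/\ unit_sphere H x0,
        unit_sphere H `&` [set x | `|T x| = `|T|] = [set x0; - x0] &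
        sup [set `|T y| | y in unit_sphere H `&` [set y | ip x0 y = 0]]
          < `|T|].
Proof.
split=> [smT|[x0 [x01 maxE supT]]].
  have [x0 [x01 Tx0]] := smooth_attains ip_norm smT.
  by exists x0; have [] := smooth_maximizer_isolated ip_norm smT x01 Tx0.
have [_ Tx0] : (unit_sphere H `&` [set x | `|T x| = `|T|]) x0.
  by rewrite maxE; left.
set S := [set _ | _ in _] in supT.
have S_ub y : S y -> y <= sup S.
  apply: ub_le_sup; exists `|T| => _ [x [/= x1 _] <-]; exact: le_op_norm.
have sup0 : 0 <= sup S.
  have [->|/set0P[y Sy]] := eqVneq S set0; first by rewrite sup0.
  by apply: le_trans (S_ub _ Sy); case: Sy => x _ <-.
(* [sup S], which is 0 for empty [S], serves as [s]; homogeneity extends the bound from unit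
   vectors. *)
apply: (smooth_of_isolated_maximizer ip_norm x01 Tx0 sup0 supT) => z xz.
have [->|z0] := eqVneq z 0; first by rewrite linear0 !normr0 mulr0.
have nz0 : 0 < `|z| by rewrite normr_gt0.
rewrite -ler_pdivrMr//; apply: S_ub; exists (`|z|^-1 *: z).
  split; first by rewrite /unit_sphere /= normrZ normfV normr_id mulVf ?gt_eqF.
  by rewrite /= ipZr xz mulr0.
by rewrite bop_scale normrZ normfV normr_id mulrC.
Qed.
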